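(* For every integer $n\ge 7$, there exists a regular language $L$ over an alphabet of size $2$, with $\mathrm{sc}(L)\le n$, such that $$\mathrm{sc}(\mathrm{root}(L))\ \ge\ n^n\left(1-\sqrt{2}\left(\frac{2}{e}\right)^{\frac n2}e^{\frac1{12}}-\sqrt{8}\,\frac{1}{\sqrt n}\,e^{\frac1{12}}\right)-\binom n2 .$$
   Context: For a language $L\subseteq\Sigma^*$ over a finite alphabet $\Sigma$, $\mathrm{root}(L)=\{w\in\Sigma^* : \exists n\ge 1 \text{ such that } w^n\in L\}$. The state complexity $\mathrm{sc}(L)$ of a regular language $L\subseteq\Sigma^*$ is the number of states of the smallest DFA over $\Sigma$ (with total transition function) recognizing $L$. *)

(* Defs.v *)
From HB Require Import structures.
From mathcomp Require Import all_boot all_order all_algebra.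
From mathcomp Require Import all_classical all_reals all_analysis.

Set Implicit Arguments.
Unset Strict Implicit.
Unset Printing Implicit Defensive.

Local Open Scope classical_set_scope.

Definition language (Sigma : finType) := set (seq Sigma).

Definition word_pow (Sigma : finType) (w : seq Sigma) (k : nat) : seq Sigma :=
  flatten (nseq k w).

Definition root_lang (Sigma : finType) (L : language Sigma) : language Sigma :=
  [set w | exists k, (1 <= k)%N /\ L (word_pow w k)].

Record dfa (Sigma : finType) := Dfa {
  dfa_state : finType;
  dfa_start : dfa_state;
  dfa_final : {set dfa_state};
  dfa_trans : dfa_state -> Sigma -> dfa_state }.

Definition dfa_run (Sigma : finType) (A : dfa Sigma) (q : dfa_state A)
  (w : seq Sigma) : dfa_state A := foldl (@dfa_trans _ A) q w.

Definition dfa_lang (Sigma : finType) (A : dfa Sigma) : language Sigma :=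
  [set w | dfa_run (dfa_start A) w \in dfa_final A].

Definition regular_lang (Sigma : finType) (L : language Sigma) : Prop :=
  exists A : dfa Sigma, dfa_lang A = L.

Definition recognized_with (Sigma : finType) (L : language Sigma) (k : nat) :
    Prop :=
  exists A : dfa Sigma, dfa_lang A = L /\ #|dfa_state A| = k.

(* The value 0 on non-regular languages is a dummy: every DFA has at least one
   state. By [regular_root_lang] it is never met on the root of a regular
   language. *)
Definition sc (Sigma : finType) (L : language Sigma) : nat :=
  if pselect (exists k, `[< recognized_with L k >]) is left h
  then ex_minn h else 0%N.

Lemma scP (Sigma : finType) (L : language Sigma) : regular_lang L ->
  recognized_with L (sc L) /\
  forall A : dfa Sigma, dfa_lang A = L -> (sc L <= #|dfa_state A|)%N.
Proof.
move=> [A hA]; rewrite /sc; case: pselect => [h|[]]; last first.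
  by exists #|dfa_state A|; apply/asboolP; exists A.
case: ex_minnP => m /asboolP hm mmin; split=> // B hB.
by apply: mmin; apply/asboolP; exists B.
Qed.

(* The state reached on w is the transformation of the states of A induced by w;
   it is accepting when one of its positive iterates sends the start state to a
   final state. *)
Definition root_dfa (Sigma : finType) (A : dfa Sigma) : dfa Sigma :=
  @Dfa Sigma {ffun dfa_state A -> dfa_state A} [ffun q => q]
    [set f : {ffun dfa_state A -> dfa_state A} |
      `[< exists k, (1 <= k)%N /\ iter k f (dfa_start A) \in dfa_final A >]]%SET
    (fun f a => [ffun q => dfa_trans (f q) a]).

Lemma root_dfa_lang (Sigma : finType) (A : dfa Sigma) :
  dfa_lang (root_dfa A) = root_lang (dfa_lang A).
Proof.
have runE w (f : dfa_state (root_dfa A)) q :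
    (dfa_run f w : {ffun _ -> _}) q = dfa_run ((f : {ffun _ -> _}) q) w.
  by elim: w f => //= a w IH f; rewrite IH /= ffunE.
have iterE w k q : iter k (dfa_run (dfa_start (root_dfa A)) w : {ffun _ -> _}) q
    = dfa_run q (word_pow w k).
  elim: k q => [//|k IH] q.
  by rewrite iterSr IH runE ffunE /word_pow /= /dfa_run foldl_cat.
apply/seteqP; split=> w; rewrite /dfa_lang /root_lang /= inE.
  by move/asboolP=> [k [k0 hk]]; exists k; rewrite -iterE.
by move=> [k [k0 hk]]; apply/asboolP; exists k; rewrite iterE.
Qed.

Lemma regular_root_lang (Sigma : finType) (L : language Sigma) :
  regular_lang L -> regular_lang (root_lang L).
Proof. by move=> [A <-]; exists (root_dfa A); apply: root_dfa_lang. Qed.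

(* Main.v *)
(* Write n = k + l with k, l coprime, l odd and both close to n/2. On the disjoint
   union of Z/k and Z/l, let one letter rotate both cycles and let the other
   identify a point of Z/k with a point of Z/l and then permute the n - 1 other
   states. By coprimality each cycle rotates alone. As long as the state missed by
   the image (the hole) stays in Z/l, the remaining n - 1 states can be permuted
   arbitrarily, and the second letter also merges them; so the transition monoid
   contains every f that identifies some a in Z/k with some b in Z/l and misses
   some state of Z/l.

   With a single state s both initial and final, f is accepting in the root
   automaton iff s is periodic under f. Following f by a map sending one point to
   s and all others to one c <> s separates any two maps, except for pairs
   (s |-> a, rest |-> b), (s |-> b, rest |-> a): this costs at most C(n, 2).

   A random f has no collision between Z/k and Z/l with probability at most
   (n - 1) / (kl + n - 1) (second moment), and covers Z/l with probability at most
   (1 - 1/n) ... (1 - (l - 1)/n) <= 2n / (2n + l(l - 1)). The sum is at most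
   12 / (n + 4), which is below sqrt 8 / sqrt n for n >= 8; for n = 7 the claimed
   bound is negative. *)
Require Import Defs.
From mathcomp Require Import all_boot all_order all_fingroup all_algebra.
From mathcomp Require Import boolp.
From mathcomp Require Import zify ring lra.
Set Implicit Arguments.
Unset Strict Implicit.
Unset Printing Implicit Defensive.
Import Order.TTheory GRing.Theory Num.Theory.

(** * Averaging over the value of a map at one point *)

Section Update.
Variables (T T' : finType).
Implicit Types (f : {ffun T -> T'}) (x : T) (c : T').

Definition update f x c : {ffun T -> T'} := [ffun y => if y == x then c else f y].

Lemma updateE f x c y : update f x c y = if y == x then c else f y.
Proof. by rewrite ffunE. Qed.

(** Exchanging the new value [c] with the old value [f x] is an involution on the pairs [(f, c)]. *)
Lemma sum_update (V : zmodType) (F : {ffun T -> T'} -> V) x :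
  ((\sum_f F f) *+ #|T'| = \sum_f \sum_c F (update f x c))%R.
Proof.
have inv : involutive (fun p : {ffun T -> T'} * T' => (update p.1 x p.2, p.1 x)).
  case=> f c /=; rewrite updateE eqxx; congr pair; apply/ffunP => y.
  by rewrite !updateE; case: (eqVneq y x) => [->|].
rewrite pair_big /= -(reindex_inj (P := xpredT) (F := fun p => F p.1) (inv_inj inv)) /=.
rewrite -(pair_big xpredT xpredT (fun f (_ : T') => F f)) /= -sumrMnl.
by apply: eq_bigr => f _; rewrite sumr_const.
Qed.
End Update.

(** * Counting maps without a collision between two disjoint sets *)

Section Collision.
Variables (T T' : finType) (A B : {set T}).
Hypotheses (AB : [disjoint A & B]) (T'_gt0 : 0 < #|T'|).
Local Open Scope ring_scope.
Let n : int := #|T'|%:Z.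

(** The collision indicator of a pair, centred, and scaled by [n] to remain an integer. *)
Let dev (p : T * T) (f : {ffun T -> T'}) : int := n * (f p.1 == f p.2)%:R - 1.

Let sum_eq (c : T') : \sum_d (d == c)%:R = 1 :> int.
Proof. by rewrite (bigD1 c) //= eqxx big1 ?addr0 // => d /negPf->. Qed.

Let AB_neq i j : i \in A -> j \in B -> j != i.
Proof.
by move=> iA jB; apply: contraTneq jB => ->; rewrite (disjointFr AB iA).
Qed.

Let n_neq0 : #|T'| != 0%N. Proof. by rewrite -lt0n. Qed.

Let mulrnz (x : int) m : x *+ m = x * m%:Z.
Proof. by rewrite -mulr_natr natz. Qed.

Let nreg (x y : int) : x *+ #|T'| = y *+ #|T'| -> x = y.
Proof. by move/eqP; rewrite eqrMn2r (negPf n_neq0) /= => /eqP. Qed.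

Let sum_dev_l (c : T') : \sum_d (n * (d == c)%:R - 1) = 0.
Proof.
by rewrite sumrB -mulr_sumr sum_eq mulr1 sumr_const /n natz subrr.
Qed.

Let sum_dev_r (c : T') : \sum_d (n * (c == d)%:R - 1) = 0.
Proof. by rewrite -[RHS](sum_dev_l c); apply: eq_bigr => d _; rewrite eq_sym. Qed.

Let dev0 i j : i \in A -> j \in B -> \sum_f dev (i, j) f = 0.
Proof.
move=> iA jB; apply: nreg; rewrite (sum_update _ i) mul0rn big1 // => f _.
rewrite -[RHS](sum_dev_l (f j)); apply: eq_bigr => c _.
by rewrite /dev /= !updateE eqxx (negPf (AB_neq iA jB)).
Qed.

(** Some point belongs to only one of the two pairs; averaging over the value there kills one factor
    and leaves the other unchanged. *)
Let dev_orth p q : p \in setX A B -> q \in setX A B -> p != q ->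
  \sum_f dev p f * dev q f = 0.
Proof.
case: p q => [i j] [i' j'] /setXP[/= iA jB] /setXP[/= i'A j'B] neq.
apply: nreg; rewrite mul0rn; case: (eqVneq i i') neq => [<-|ii'] neq.
  have jj' : j != j' by apply: contraNneq neq => ->.
  rewrite (sum_update _ j) big1 // => f _.
  rewrite -[RHS](mul0r (dev (i, j') f)) -[X in _ = X * _](sum_dev_r (f i)) mulr_suml.
  apply: eq_bigr => c _.
  by rewrite /dev /= !updateE eqxx ![_ == j]eq_sym (negPf (AB_neq iA jB)) (negPf jj').
rewrite (sum_update _ i) big1 // => f _.
rewrite -[RHS](mul0r (dev (i', j') f)) -[X in _ = X * _](sum_dev_l (f j)) mulr_suml.
apply: eq_bigr => c _; rewrite /dev /= !updateE eqxx (negPf (AB_neq iA jB)).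
by rewrite (negPf (AB_neq iA j'B)) [_ == i]eq_sym (negPf ii').
Qed.

Let N : int := #|{ffun T -> T'}|%:Z.

Let dev_sqr p : p \in setX A B -> \sum_f dev p f * dev p f = N * (n - 1).
Proof.
case: p => i j /setXP[/= iA jB].
apply: nreg; rewrite (sum_update _ i).
rewrite (eq_bigr (fun=> n * (n - 1))) => [|f _].
  by rewrite sumr_const !mulrnz -/n -/N; ring.
under eq_bigr => c _.
  rewrite /dev /= !updateE eqxx (negPf (AB_neq iA jB)).
  rewrite (_ : _ * _ = (n * n - 2 * n) * (c == f j)%:R + 1); last first.
    by case: (c == f j) => /=; ring.
  over.
by rewrite big_split /= -mulr_sumr sum_eq sumr_const mulrnz -/n; ring.
Qed.

(* One-sided Chebyshev inequality for the number of pairs of [A * B] that [f]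
   identifies: these events are pairwise independent. *)
Lemma card_no_collision :
  (#|[set f : {ffun T -> T'} | [forall i in A, forall j in B, f i != f j]]|
    * (#|A| * #|B| + #|T'|.-1) <= #|T'|.-1 * #|{ffun T -> T'}|)%N.
Proof.
set S := [set f | _]; set ab := (#|A| * #|B|)%N.
pose Z f := \sum_(p in setX A B) dev p f.
have ZS f : f \in S -> Z f = - ab%:Z.
  rewrite inE => /forall_inP fS; rewrite /Z (eq_bigr (fun=> -1)) => [|[i j]].
    by rewrite sumr_const cardsX /ab mulNrn natz.
  by case/setXP=> /= iA jB; rewrite /dev /= (negPf (forall_inP (fS _ iA) _ jB)) mulr0.
have sumZ : \sum_f Z f = 0.
  rewrite exchange_big big1 //= => -[i j] /setXP[/= iA jB]; exact: dev0.
have sumZ2 : \sum_f Z f * Z f = N * (n - 1) * ab%:Z.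
  under eq_bigr => f _ do rewrite /Z mulr_suml.
  rewrite exchange_big /= (eq_bigr (fun=> N * (n - 1))) => [|p pAB].
    by rewrite sumr_const cardsX mulrnz.
  under eq_bigr => f _ do rewrite mulr_sumr.
  rewrite exchange_big /= (bigD1 p) //= dev_sqr // big1 ?addr0 // => q /andP[qAB qp].
  by rewrite dev_orth // eq_sym.
(* The optimal shift: the variance [(n - 1) * ab] of [Z] divided by the deviation [ab]. *)
pose t : int := n - 1.
have sumC : \sum_f (Z f - t) * (Z f - t) = N * t * (ab%:Z + t).
  rewrite (eq_bigr (fun f => Z f * Z f - (2 * t) * Z f + t * t)) => [|f _]; last by ring.
  rewrite big_split sumrB /= -mulr_sumr sumZ sumZ2 sumr_const mulrnz -/N -/t; ring.
have t_ge0 : 0 <= t by rewrite /t /n; lia.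
have le : #|S|%:Z * ((ab%:Z + t) * (ab%:Z + t)) <= N * t * (ab%:Z + t).
  rewrite -sumC (bigID (mem S)) /= -[leLHS]addr0 lerD //; last first.
    by apply: sumr_ge0 => f _; apply: sqr_ge0.
  rewrite (eq_bigr (fun=> (ab%:Z + t) * (ab%:Z + t))) => [|f fS].
    by rewrite sumr_const mulrnz mulrC.
  by rewrite ZS //; ring.
have tE : t = #|T'|.-1%:Z by rewrite /t /n; lia.
have [u0|u_gt0] := leqP (ab + #|T'|.-1) 0.
  by rewrite (eqP (_ : ab + _ == 0)%N) -?leqn0 // muln0.
suff : #|S|%:Z * (ab%:Z + t) <= N * t by rewrite tE /N; lia.
rewrite -(ler_pM2r (_ : 0 < ab%:Z + t)) -?mulrA // tE; lia.
Qed.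
End Collision.

(** * Counting maps whose image covers a given set *)

(** Union bound over the injective choices [p] of preimages for the points of [H]: each [p]
    prescribes [f] at [#|H|] points. *)
Lemma card_codom_sup (T T' H : finType) (iota : H -> T') (y0 : T') :
  injective iota ->
  #|[set f : {ffun T -> T'} | [forall b, iota b \in codom f]]|
    <= #|T| ^_ #|H| * #|T'| ^ (#|T| - #|H|).
Proof.
move=> inj; set S := [set f | _].
have fib (p : {ffun H -> T}) : injectiveb p ->
    #|[set f : {ffun T -> T'} | [forall b, f (p b) == iota b]]|
      <= #|T'| ^ (#|T| - #|H|).
  move=> /injectiveP pinj; set X := [set f | _].
  (* Overwriting the prescribed values by [y0] loses no information and leaves a map supported off
     the image of [p]. *)
  pose r (f : {ffun T -> T'}) := [ffun x => if x \in codom p then y0 else f x].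
  have rinj : {in X &, injective r}.
    move=> f g; rewrite !inE => /forallP fX /forallP gX /ffunP e.
    apply/ffunP => x; have := e x; rewrite !ffunE; case: ifP => // /codomP[b ->] _.
    by rewrite (eqP (fX b)) (eqP (gX b)).
  rewrite -(card_in_imset rinj) -(card_codom pinj) -(cardC (mem (codom p))) addKn.
  rewrite -cardsT -(card_pffun_on y0).
  apply/subset_leq_card/subsetP => g /imsetP[f fX ->]; apply/pffun_onP.
  split=> [|y _]; last by rewrite inE.
  by apply/subsetP => x; rewrite !inE ffunE; case: ifP => //; rewrite eqxx.
rewrite -(card_inj_ffuns H T) -sum_nat_const.
suff le : #|S| <= \sum_(p in [set p : {ffun H -> T} | injectiveb p])
    #|[set f : {ffun T -> T'} | [forall b, f (p b) == iota b]]|.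
  by apply: (leq_trans le); apply: leq_sum => p; rewrite inE => /fib.
rewrite -sum1_card big_mkcond /=.
under [leqRHS]eq_bigr => p _ do rewrite -sum1_card big_mkcond.
rewrite exchange_big /=; apply: leq_sum => f _; case: ifP => // fS.
move: fS; rewrite inE => /forallP fS.
pose p := [ffun b => iinv (fS b)].
have pE b : f (p b) = iota b by rewrite ffunE f_iinv.
rewrite (bigD1 p) /= ?inE; last first.
  by apply/injectiveP => b c e; apply: inj; rewrite -!pE e.
by rewrite (_ : [forall b, _]) //; apply/forallP => b; rewrite pE.
Qed.

(** Birthday estimate; for [l < n] the inductive step is [(1 - l/n) * (1 + l(l+1)/(2n)) <= 1 +
    l(l-1)/(2n)]. *)
Lemma ffact_bound n l : n ^_ l * (2 * n + l * l.-1) <= 2 * n * n ^ l.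
Proof.
elim: l => [|l IH]; first by rewrite ffactn0 expn0 muln1 mul1n muln0 addn0.
rewrite ffactnSr expnS.
have [nl|ln] := leqP n l; first by rewrite (eqP nl) muln0 mul0n.
suff h : (n - l) * (2 * n + l.+1 * l) <= n * (2 * n + l * l.-1).
  rewrite -mulnA /=; apply: leq_trans (leq_mul (leqnn _) h) _.
  by rewrite mulnCA [leqRHS]mulnCA leq_mul2l IH orbT.
rewrite -{2 3 4}(subnK (ltnW ln)); move: (n - l) => d.
case: l {ln IH} => [|l] /=; first by rewrite !muln0 !addn0.
suff -> : (d + l.+1) * (2 * (d + l.+1) + l.+1 * l)
  = d * (2 * (d + l.+1) + l.+2 * l.+1) + (l.+1 ^ 3 + l.+1 ^ 2) by apply: leq_addr.
by ring.
Qed.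

(** * Transformations induced by words on the two cycles *)

Section TwoCycles.
Variables k' l' : nat.
Let k := k'.+3.
Let l := l'.+3.
Hypotheses (l_odd : odd l) (co_kl : coprime k l).

Definition state : finType := ('I_k'.+3 + 'I_l'.+3)%type.

Definition rotl_fun (q : state) : state := if q is inl a then inl (a + 1)%R else q.
Definition rotr_fun (q : state) : state := if q is inr b then inr (b + 1)%R else q.

Lemma rotl_inj : injective rotl_fun.
Proof.
apply: (can_inj (g := fun q => if q is inl a then inl (a - 1)%R else q)).
by case=> // a; rewrite /rotl_fun addrK.
Qed.
Lemma rotr_inj : injective rotr_fun.
Proof.
apply: (can_inj (g := fun q => if q is inr a then inr (a - 1)%R else q)).
by case=> // a; rewrite /rotr_fun addrK.
Qed.

Definition rotl : {perm state} := perm rotl_inj.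
Definition rotr : {perm state} := perm rotr_inj.

Definition hole : state := inr 0%R.
Definition swap01 : {perm state} := tperm (inl 0%R) (inl 1%R).
(* [rotr] with [inl (-1)] in place of the hole. *)
Definition rotr_in : {perm state} := (rotr ^ tperm hole (inl (-1)%R))%g.
(** The factors have disjoint supports, hence commute; [rotr_in] is an [l]-cycle that meets the
    first cycle in [inl (-1)] only and so ties the two cycles together. *)
Definition shuffle : {perm state} := (swap01 * rotr_in)%g.

Definition letter_a (q : state) : state := rotr (rotl q).
Definition letter_b (q : state) : state :=
  shuffle (if q == hole then inl 0%R else q).
Definition step (q : state) (c : bool) : state := if c then letter_a q else letter_b q.

Definition realized (f : state -> state) := exists w, forall q, foldl step q w = f q.

Lemma realized_id : realized id. Proof. by exists [::]. Qed.

Lemma eq_realized f g : f =1 g -> realized f -> realized g.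
Proof. by move=> e [w wE]; exists w => q; rewrite wE. Qed.

Lemma realized_comp f g : realized f -> realized g -> realized (f \o g).
Proof. by move=> [u uE] [v vE]; exists (v ++ u) => q; rewrite foldl_cat vE uE. Qed.

Lemma realized_a : realized letter_a. Proof. by exists [:: true]. Qed.
Lemma realized_b : realized letter_b. Proof. by exists [:: false]. Qed.

Lemma realized_perm (s : {perm state}) i : realized s -> realized (s ^+ i)%g.
Proof.
move=> gs; elim: i => [|i IH]; first by apply: eq_realized realized_id => q; rewrite perm1.
by apply: eq_realized (realized_comp gs IH) => q; rewrite expgSr permM.
Qed.

Lemma rotr_inl a : rotr (inl a) = inl a. Proof. by rewrite permE. Qed.

Lemma rotlXl i a : (rotl ^+ i)%g (inl a) = inl (a + i%:R)%R.
Proof.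
elim: i => [|i IH]; first by rewrite perm1 addr0.
by rewrite expgSr permM IH permE [LHS]/= -addrA natr1.
Qed.
Lemma rotlXr i b : (rotl ^+ i)%g (inr b) = inr b.
Proof. by elim: i => [|i IH]; rewrite ?perm1 // expgSr permM IH permE. Qed.
Lemma rotrXr i b : (rotr ^+ i)%g (inr b) = inr (b + i%:R)%R.
Proof.
elim: i => [|i IH]; first by rewrite perm1 addr0.
by rewrite expgSr permM IH permE [LHS]/= -addrA natr1.
Qed.
Lemma rotrXl i a : (rotr ^+ i)%g (inl a) = inl a.
Proof. by elim: i => [|i IH]; rewrite ?perm1 // expgSr permM IH permE. Qed.

Lemma Zp_nat0 m : (m.+2%:R = 0 :> 'I_m.+2)%R.
Proof. by apply: val_inj; rewrite Zp_nat; apply: modnn. Qed.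

Lemma rotl_order : (rotl ^+ k = 1)%g.
Proof.
by apply/permP => -[a|b]; rewrite ?rotlXl ?rotlXr perm1 // Zp_nat0 addr0.
Qed.
Lemma rotr_order : (rotr ^+ l = 1)%g.
Proof.
by apply/permP => -[a|b]; rewrite ?rotrXl ?rotrXr perm1 // Zp_nat0 addr0.
Qed.

Lemma commute_rot : commute rotl rotr.
Proof. by apply/permP => -[a|b]; rewrite !permM !permE. Qed.

(** The word is a power of [letter_a] whose exponent comes from the Chinese remainder theorem. *)
Lemma realized_rot i j : realized (rotl ^+ i * rotr ^+ j)%g.
Proof.
have h : realized (rotl * rotr)%g.
  by apply: eq_realized realized_a => q; rewrite permM.
apply: eq_realized (realized_perm (chinese k l i j) h) => q.
rewrite expgMn; last exact: commute_rot.
rewrite -(expg_mod (chinese _ _ _ _) rotl_order) chinese_modl //.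
by rewrite -(expg_mod (chinese _ _ _ _) rotr_order) chinese_modr // !expg_mod
  ?rotl_order ?rotr_order.
Qed.

Lemma realized_rotl i : realized (rotl ^+ i)%g.
Proof. by apply: eq_realized (realized_rot i 0) => q; rewrite expg0 mulg1. Qed.
Lemma realized_rotr i : realized (rotr ^+ i)%g.
Proof. by apply: eq_realized (realized_rot 0 i) => q; rewrite expg0 mul1g. Qed.

(* Whatever the realized map does at the hole is irrelevant: it will only be
   applied after a map that misses the hole. *)
Definition induced (f : state -> state) :=
  exists2 g, realized g & forall q, q != hole -> g q = f q.

Definition avoids (f : state -> state) := forall q, q != hole -> f q != hole.

Lemma induced_comp f g : avoids g -> induced f -> induced g -> induced (f \o g).
Proof.
move=> ag [f1 gf1 f1E] [g1 gg1 g1E]; exists (f1 \o g1); first exact: realized_comp.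
by move=> q qh /=; rewrite g1E // f1E // ag.
Qed.

Lemma eq_induced f g : (forall q, q != hole -> f q = g q) -> induced f -> induced g.
Proof. by move=> e [f1 gf1 f1E]; exists f1 => // q qh; rewrite f1E ?e. Qed.

Lemma realized_induced f : realized f -> induced f.
Proof. by move=> gf; exists f. Qed.

Lemma realized_of_induced f g : induced f -> realized g ->
  (forall q, g q != hole) -> realized (f \o g).
Proof.
move=> [f1 gf1 f1E] gg gh; apply: eq_realized (realized_comp gf1 gg) => q /=.
exact: f1E.
Qed.

(** Fixing the hole selects one permutation of all states for each permutation of the others. *)
Definition induced_perms : {set {perm state}} :=
  [set s : {perm state} | (s hole == hole) && `[< induced s >]].

Lemma induced_permsP (s : {perm state}) :
  reflect (s hole = hole /\ induced s) (s \in induced_perms).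
Proof.
by rewrite inE; apply: (iffP andP) => -[h1 h2]; split;
  by [apply/eqP | apply/asboolP].
Qed.

Lemma perm_avoids (s : {perm state}) : s hole = hole -> avoids s.
Proof. by move=> sh q; apply: contraNneq => e; rewrite -(perm_inj (etrans e (esym sh))). Qed.

Lemma group_set_induced : group_set induced_perms.
Proof.
apply/group_setP; split.
  apply/induced_permsP; rewrite perm1; split=> //.
  by apply: eq_induced (realized_induced realized_id) => q _; rewrite perm1.
move=> s t /induced_permsP[sh si] /induced_permsP[th ti]; apply/induced_permsP.
split; first by rewrite permM sh.
apply: eq_induced (induced_comp (perm_avoids sh) ti si) => q _.
by rewrite permM.
Qed.
Canonical induced_group := Group group_set_induced.

Lemma rotr_in_hole : rotr_in hole = hole.
Proof. by rewrite /rotr_in conjgE !permM tpermV tpermL rotr_inl tpermR. Qed.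

Lemma one_neq_m1 : (1 != -1 :> 'I_k'.+3)%R.
Proof. by apply/eqP => /(congr1 val) /=; rewrite !modn_small //; lia. Qed.

Lemma m1_neq0 : (-1 != 0 :> 'I_k'.+3)%R.
Proof. by rewrite oppr_eq0 oner_eq0. Qed.

Lemma shuffle_hole : shuffle hole = hole.
Proof. by rewrite permM tpermD // rotr_in_hole. Qed.

Lemma rotr_in_inl a : a != (-1)%R -> rotr_in (inl a) = inl a.
Proof.
move=> am; have ne : inl (-1)%R != inl a :> state by rewrite eq_sym; apply: contraNneq am => -[->].
by rewrite /rotr_in conjgE !permM tpermV [tperm _ _ (inl a)]tpermD // rotr_inl tpermD.
Qed.

Lemma commute_swap_rotr_in : commute swap01 rotr_in.
Proof.
apply/commgP/conjg_fixP.
by rewrite tpermJ !rotr_in_inl ?one_neq_m1 // eq_sym m1_neq0.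
Qed.

Lemma tperm_hole x y : x != hole -> y != hole -> tperm x y hole = hole.
Proof. by move=> xh yh; rewrite tpermD. Qed.

Lemma rotl_induced : rotl \in induced_group.
Proof.
apply/induced_permsP; split; first by rewrite permE.
exact/realized_induced/(realized_rotl 1).
Qed.

Lemma shuffle_induced : shuffle \in induced_group.
Proof.
apply/induced_permsP; split; first exact: shuffle_hole.
exists letter_b; first exact: realized_b.
by move=> q /negPf qh; rewrite /letter_b qh.
Qed.

(* As [l] is odd, the [l]-th power of [shuffle] kills its [l]-cycle only. *)
Lemma swap01_induced : swap01 \in induced_group.
Proof.
have -> : swap01 = (shuffle ^+ l)%g.
  rewrite expgMn; last exact: commute_swap_rotr_in.
  rewrite -conjXg rotr_order conj1g mulg1 -(odd_double_half l) l_odd -muln2 mulnC expgD expgM.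
  by rewrite expg2 tperm2 expg1n mulg1.
by rewrite groupX // shuffle_induced.
Qed.

Lemma rotr_in_induced : rotr_in \in induced_group.
Proof.
by rewrite -(groupMl _ swap01_induced) shuffle_induced.
Qed.

(** A transitive relation stable under the group: linking all states but the hole yields every
    transposition of them. *)
Definition linked x y := tperm x y \in induced_group.

Lemma linkedC x y : linked x y = linked y x.
Proof. by rewrite /linked tpermC. Qed.

Lemma linked_perm s x y : s \in induced_group -> linked x y -> linked (s x) (s y).
Proof. by move=> sG xy; rewrite /linked -tpermJ groupJ. Qed.

Lemma linked_trans x y z : linked x y -> linked y z -> linked x z.
Proof.
have [->//|xy] := eqVneq x y; have [->|xz xyG yzG] := eqVneq x z.
  by rewrite /linked tperm1.
have := linked_perm yzG xyG; rewrite tpermL tpermD //; by rewrite eq_sym.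
Qed.

(** Conjugating [swap01] by powers of [rotl] links consecutive points. *)
Lemma linked_inl a c : linked (inl a) (inl c).
Proof.
have h i : linked (inl 0%R) (inl i%:R%R).
  elim: i => [|i IH]; first by rewrite /linked tperm1.
  apply: linked_trans IH _.
  have := linked_perm (groupX i rotl_induced) swap01_induced.
  by rewrite !rotlXl add0r addrC natr1.
rewrite -(natr_Zp a) -(natr_Zp c); apply: (linked_trans _ (h _)).
by rewrite linkedC.
Qed.

(** Powers of [rotr_in] fix [inl 0] and carry [inl (-1)] to each nonzero point of the second
    cycle. *)
Lemma linked_inr b : b != 0%R -> linked (inl 0%R) (inr b).
Proof.
move=> b0.
have := linked_perm (groupX b rotr_in_induced) (linked_inl 0%R (-1)%R).
have -> : (rotr_in ^+ b)%g (inl 0%R) = inl 0%R.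
  by elim: (b : nat) => [|i IH]; rewrite ?perm1 // expgSr permM IH rotr_in_inl // eq_sym m1_neq0.
rewrite -conjXg conjgE !permM tpermV tpermR rotrXr add0r natr_Zp tpermD //.
by rewrite eq_sym.
Qed.

Lemma linked_all x y : x != hole -> y != hole -> linked x y.
Proof.
have h z : z != hole -> linked (inl 0%R) z.
  case: z => [a|b] zh; first exact: linked_inl.
  by apply: linked_inr; apply: contraNneq zh => ->.
by move=> /h xl /h; apply: linked_trans; rewrite linkedC.
Qed.

(** Induction on the number of moved points: following [s] by [tperm x (s x)] makes [x] fixed and
    moves no point that [s] fixed. *)
Lemma fix_hole_induced (s : {perm state}) : s hole = hole -> s \in induced_group.
Proof.
have [m] := ubnP #|[set x | s x != x]|; elim: m s => // m IH s lem sh.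
have [|[x]] := set_0Vmem [set x | s x != x].
  move=> s0; suff -> : s = 1%g by apply: group1.
  apply/permP => x; rewrite perm1; apply/eqP; apply: contraFT (in_set0 x).
  by rewrite -s0 inE.
rewrite inE => sx.
have xh : x != hole by apply: contraNneq sx => ->; apply/eqP.
have sxh : s x != hole by apply: (perm_avoids sh).
rewrite -(groupMr _ (linked_all xh sxh)) IH ?permM ?sh ?tperm_hole //.
rewrite -ltnS; apply: leq_trans lem; rewrite ltnS; apply/proper_card/properP; split.
  apply/subsetP => z; rewrite !inE permM; apply: contra => /eqP sz.
  rewrite sz tpermD //; first by apply: contraNneq sx => ->; apply/eqP.
  by apply: contraNneq sx => e; rewrite (perm_inj (etrans e (esym sz))) sz.
by exists x; rewrite !inE ?sx // permM tpermR eqxx.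
Qed.

Definition merge_into (x y q : state) : state := if q == x then y else q.

Lemma merge_into_conj (s : {perm state}) x y q :
  s (merge_into x y ((s^-1)%g q)) = merge_into (s x) (s y) q.
Proof.
rewrite /merge_into -(inj_eq (@perm_inj _ s)) permKV; case: ifP => // _.
by rewrite permKV.
Qed.

(** The image of [letter_b] misses the hole, so the inverse of [shuffle], being induced, can undo
    the shuffling and leave the bare merge. *)
Lemma realized_merge_hole : realized (merge_into hole (inl 0%R)).
Proof.
have [_ si] := induced_permsP _ (groupVr shuffle_induced).
apply: eq_realized (realized_of_induced si realized_b _) => q /=.
  by rewrite permK.
by apply: (perm_avoids shuffle_hole); case: ifP => // /negbT.
Qed.

Lemma realized_merge a b : realized (merge_into (inr b) (inl a)).
Proof.
pose r := (rotl ^+ a * rotr ^+ b)%g.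
have ra : r (inl 0%R) = inl a by rewrite permM rotlXl rotrXl add0r natr_Zp.
have rb : r hole = inr b by rewrite permM rotlXr rotrXr add0r natr_Zp.
have gr : realized r by apply: realized_rot.
have gV : realized (r^-1)%g by rewrite invg_expg; apply: realized_perm.
apply: eq_realized (realized_comp gr (realized_comp realized_merge_hole gV)) => q /=.
by rewrite merge_into_conj ra rb.
Qed.

(** A merge across the cycles is already realized; conjugating it by a permutation that fixes the
    hole transports it to [x] and [y]. *)
Lemma induced_merge x y : x != hole -> y != hole -> x != y -> induced (merge_into x y).
Proof.
move=> xh yh xy.
pose p : state := inr 1%R; pose o : state := inl 0%R.
have ph : p != hole by [].
pose s := (tperm p x * tperm (tperm p x o) y)%g.
have th : tperm p x o != hole.
  by apply: (perm_avoids (tperm_hole ph xh)).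
have sh : s hole = hole by rewrite permM !tperm_hole.
have so : s o = y by rewrite permM tpermL.
have sp : s p = x.
  rewrite permM tpermL tpermD //; last by rewrite eq_sym.
  by rewrite -{2}(tpermL p x) (inj_eq perm_inj).
have sVh : (s^-1)%g hole = hole by rewrite -{1}sh permK.
have [_ si] := induced_permsP _ (fix_hole_induced sh).
have [_ sVi] := induced_permsP _ (fix_hole_induced sVh).
have av : avoids (merge_into p o) by move=> q qh; rewrite /merge_into; case: ifP.
have fi : induced (merge_into p o) by apply/realized_induced/realized_merge.
apply: eq_induced (induced_comp (perm_avoids sVh) (induced_comp av si fi) sVi) => q _ /=.
by rewrite merge_into_conj so sp.
Qed.

(** Induction on the number of missed states, images being taken off the hole. An injective map
    extends to a permutation; otherwise [f x = f y], and sending [x] to a missed state [z] gives a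
    [g] with larger image such that [f] is [g] after [merge_into x y]. *)
Lemma avoids_induced f : avoids f -> induced f.
Proof.
have [m] := ubnP (#|state| - #|f @: [set~ hole]|); elim: m f => // m IH f lem fh.
have [finj|] := boolP (dinjectiveb f (mem [set~ hole])).
  have {}finj := dinjectiveP _ _ finj.
  pose g q := if q == hole then hole else f q.
  have ginj : injective g.
    move=> x y; rewrite /g; case: eqP => [->|/eqP xh]; case: eqP => [->|/eqP yh] //.
    - by move=> e; move: (fh _ yh); rewrite -e eqxx.
    - by move=> e; move: (fh _ xh); rewrite e eqxx.
    - by apply: finj; rewrite !inE.
  have gh : perm ginj hole = hole by rewrite permE /g eqxx.
  have [_] := induced_permsP _ (fix_hole_induced gh).
  by apply: eq_induced => q qh; rewrite permE /g (negPf qh).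
move=> ninj; have [x xh [y]] := dinjectivePn _ _ ninj.
rewrite !inE in xh *; move=> /andP[yx yh] fxy.
have [z zh zf] : exists2 z, z != hole & z \notin f @: [set~ hole].
  have /properP[_ [z]] : f @: [set~ hole] \proper [set~ hole].
    rewrite properEcard; apply/andP; split.
      by apply/subsetP => _ /imsetP[q qh ->]; move: qh; rewrite !inE; apply: fh.
    rewrite ltn_neqAle leq_imset_card andbT; apply: contra ninj => /imset_injP ninj.
    exact/dinjectiveP.
  by rewrite !inE => zh zf; exists z.
pose g q := if q == x then z else f q.
have gh : avoids g by move=> q qh; rewrite /g; case: ifP => // _; apply: fh.
have gi : induced g.
  apply: IH => //; rewrite -ltnS; apply: leq_trans lem; rewrite ltnS ltn_sub2l //.
    apply: leq_trans (max_card [set~ hole]).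
    rewrite ltn_neqAle leq_imset_card andbT; apply: contra ninj => /imset_injP ninj.
    exact/dinjectiveP.
  apply/proper_card/properP; split; last first.
    by exists z => //; apply/imsetP; exists x; rewrite ?inE // /g eqxx.
  apply/subsetP => _ /imsetP[q qh ->]; apply/imsetP.
  have [->|qx] := eqVneq q x; last by exists q; rewrite // /g (negPf qx).
  by exists y; rewrite ?inE // /g (negPf yx).
have av : avoids (merge_into x y) by move=> q qh; rewrite /merge_into; case: ifP.
rewrite eq_sym in yx.
apply: eq_induced (induced_comp av gi (induced_merge xh yh yx)) => q _ /=.
rewrite /g /merge_into; case: (eqVneq q x) => [->|/negPf->//].
by rewrite eq_sym (negPf yx).
Qed.

(* Rotations bring the identified pair and the missing state to the hole. *)
Lemma realized_collapsing f a b c :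
  f (inl a) = f (inr b) -> (forall q, f q != inr c) -> realized f.
Proof.
move=> fab fc.
pose r := (rotr ^+ b)%g; pose t := (rotr ^+ c)%g.
have gr : realized (r^-1)%g by rewrite /r invg_expg; apply/realized_perm/realized_rotr.
have rb : r hole = inr b by rewrite rotrXr add0r natr_Zp.
have tc : t hole = inr c by rewrite rotrXr add0r natr_Zp.
have ra : r (inl a) = inl a by rewrite rotrXl.
(* [f] is the inverse of [r], then the merge of the hole into [inl a], then [g], then [t]. *)
pose g q := (t^-1)%g (f (r q)).
have gh q : g q != hole by rewrite -(inj_eq (@perm_inj _ t)) permKV tc.
have gi : induced g by apply: avoids_induced.
have fo : forall q, merge_into hole (inl a) q != hole.
  by move=> q; rewrite /merge_into; case: ifP => // /negbT.
have h := realized_of_induced gi (realized_merge a 0%R) fo.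
apply: eq_realized (realized_comp (realized_rotr c) (realized_comp h gr)) => q /=.
rewrite /g permKV /merge_into -(inj_eq (@perm_inj _ r)) permKV -/hole rb.
by case: eqP => [->|_]; rewrite ?ra ?permKV.
Qed.

End TwoCycles.

(** * State complexity from distinguishable words *)

Lemma sc_ge_card (Sigma S : finType) (L : language Sigma) (X : {set S})
    (word : S -> seq Sigma) :
  regular_lang L ->
  {in X &, forall x y, x != y ->
     exists v, ~ (L (word x ++ v) <-> L (word y ++ v))} ->
  #|X| <= sc L.
Proof.
move=> /scP[[A [AL <-]] _] sep.
have inj : {in X &, injective (fun x => dfa_run (dfa_start A) (word x))}.
  move=> x y xX yX exy; apply/eqP/negPn/negP => /(sep x y xX yX)[v []].
  by rewrite -AL /dfa_lang /= /dfa_run !foldl_cat; move: exy; rewrite /dfa_run => ->.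
by rewrite -(card_in_imset inj) max_card.
Qed.

Lemma dfa_run_word_pow (Sigma : finType) (A : dfa Sigma) q w j :
  dfa_run q (word_pow w j) = iter j (fun p : dfa_state A => dfa_run p w) q.
Proof.
by elim: j q => // j IH q; rewrite iterSr -IH /word_pow /dfa_run -foldl_cat.
Qed.

(** * Separating maps by returns to the start state *)

Section Return.
Variables (T : finType) (s : T).
Implicit Types (f g : T -> T) (y c : T).

Definition returns f := exists2 j, 0 < j & iter j f s = s.

Definition pin y c (q : T) := if q == y then s else c.

Lemma stuck_returns f x : f s = x -> f x = x -> x != s -> ~ returns f.
Proof.
move=> fs fx xs [[//|j] _]; rewrite iterSr fs iter_fix // => e.
by rewrite e eqxx in xs.
Qed.

Definition pin_separated f g := exists y c,
  [/\ c != s, returns (pin y c \o f) & ~ returns (pin y c \o g)].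

(** Pinning [y = f s] makes [f] return at once, while [g] goes from [s] to [c] and stays there. *)
Lemma pin_separated_start f g c :
  f s != g s -> c != s -> g c != f s -> pin_separated f g.
Proof.
move=> fgs cs gc; exists (f s), c; split=> //.
  by exists 1 => //=; rewrite /pin eqxx.
by apply: (@stuck_returns _ c) => //=; rewrite /pin ?(negPf gc) // eq_sym (negPf fgs).
Qed.

(** With [y = f x] and [c = x], the pinned [f] runs through [s], [x], [s], while the pinned [g]
    stays at [x]. *)
Lemma pin_separated_other f g x :
  f s = g s -> f x != g x -> f x != f s -> pin_separated f g.
Proof.
move=> fgs fgx fx; have xs : x != s by apply: contraNneq fx => ->.
exists (f x), x; split=> //.
  exists 2 => //=; rewrite /pin [f s == _]eq_sym (negPf fx) eqxx //.
apply: (@stuck_returns _ x) => //=; rewrite /pin -?fgs.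
  by rewrite [f s == _]eq_sym (negPf fx).
by rewrite eq_sym (negPf fgx).
Qed.

Lemma pin_separated_or f g : f <> g ->
  [\/ pin_separated f g, pin_separated g f |
      [/\ f s != g s, forall c, c != s -> g c = f s
        & forall c, c != s -> f c = g s]].
Proof.
move=> fg; have [fgs|fgs] := eqVneq (f s) (g s).
  have [x fgx] : exists x, f x != g x.
    apply/existsP; apply: contra_notT fg => /existsPn fg; apply/funext => x.
    by have := fg x; rewrite negbK => /eqP.
  have [fx|] := eqVneq (f x) (f s); last by move/(pin_separated_other fgs fgx)/Or31; apply.
  (* Here [f x = f s], so [g x] differs from [g s] and the two maps exchange roles. *)
  apply/Or32/(@pin_separated_other _ _ x) => //; first by rewrite eq_sym.
  by rewrite -fgs -fx eq_sym.
have [/existsP[c /andP[cs gc]]|/existsPn gc] := boolP [exists c, (c != s) && (g c != f s)].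
  exact/Or31/(pin_separated_start fgs cs gc).
have [/existsP[c /andP[cs fc]]|/existsPn fc] := boolP [exists c, (c != s) && (f c != g s)].
  by apply/Or32/(@pin_separated_start _ _ c); rewrite // eq_sym.
by apply: Or33; split=> // c cs; apply/eqP; [move: (gc c)|move: (fc c)]; rewrite cs negbK.
Qed.

(* Each pair of [T] yields one of the two exceptional maps with that image. *)
Definition pair_map (A : {set T}) : {ffun T -> T} :=
  let a := odflt s [pick x in A] in
  [ffun q => if q == s then a else odflt s [pick x in A :\ a]].

Definition pair_maps : {set {ffun T -> T}} :=
  [set pair_map A | A in [set A : {set T} | #|A| == 2]].

Lemma card_pair_maps : #|pair_maps| <= 'C(#|T|, 2).
Proof. by rewrite -card_draws leq_imset_card. Qed.

(** The element that [pair_map] picks first is the value at [s] of one of the two maps; that map is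
    the pair map. *)
Lemma pair_maps_exceptional (f g : {ffun T -> T}) : f s != g s ->
    (forall c, c != s -> g c = f s) -> (forall c, c != s -> f c = g s) ->
  (f \in pair_maps) || (g \in pair_maps).
Proof.
move=> fgs gE fE; set a := f s in fgs gE *; set b := g s in fgs fE *.
pose A := [set a; b].
have A2 : A \in [set A : {set T} | #|A| == 2] by rewrite inE cards2 fgs.
have pickE x y : A = [set x; y] -> x != y -> odflt s [pick z in A :\ x] = y.
  move=> -> xy; case: pickP => [z|/(_ y)]; rewrite !inE; last by rewrite eq_sym xy eqxx orbT.
  by case: (z == x) => //= /eqP.
have : odflt s [pick z in A] \in A.
  by case: pickP => [z //|/(_ a)]; rewrite !inE eqxx.
rewrite !inE => /orP[]/eqP e; apply/orP; [left|right]; apply/imsetP; exists A => //.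
  apply/ffunP => q; rewrite ffunE e (pickE a b) //; case: eqVneq => [->//|]; exact: fE.
apply/ffunP => q; rewrite ffunE e (pickE b a) //; last by rewrite eq_sym.
  by case: eqVneq => [->//|]; exact: gE.
by rewrite /A setUC.
Qed.
End Return.

(** * The two-cycle automaton and its collapsing maps *)

Section Automaton.
Variables k' l' : nat.
Let k := k'.+3.
Let l := l'.+3.
Let n := k + l.
Hypotheses (l_odd : odd l) (co_kl : coprime k l).
Notation Q := (state k' l').
Let s : Q := inl 0%R.

Definition two_cycle_dfa : dfa bool :=
  @Dfa bool Q s [set s]%SET (@step k' l').

Lemma root_two_cycle w :
  root_lang (dfa_lang two_cycle_dfa) w <-> returns s (foldl (@step k' l') ^~ w).
Proof.
rewrite /root_lang /dfa_lang /=; split.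
  by move=> [j [j0]]; rewrite dfa_run_word_pow inE => /eqP e; exists j.
by move=> [j j0 e]; exists j; split=> //; rewrite dfa_run_word_pow inE; apply/eqP.
Qed.

Definition collapsing : {set {ffun Q -> Q}} :=
  [set f : {ffun Q -> Q} | [exists a, exists b, f (inl a) == f (inr b)]
    && [exists c, inr c \notin codom f]].

Lemma collapsing_realized f : f \in collapsing -> realized f.
Proof.
rewrite inE => /andP[/existsP[a /existsP[b /eqP fab]] /existsP[c fc]].
apply: (realized_collapsing l_odd co_kl fab (c := c)) => q.
by apply: contraNneq fc => <-; apply: codom_f.
Qed.

(** All states but [y] are merged, and the values are only [s], in the first cycle, and [c]; so each
    cycle has a point other than [y], and the second one a missed state. *)
Lemma pin_realized y c : realized (pin s y c : Q -> Q).
Proof.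
have [a ya] : exists a, inl a != y.
  have [->|?] := eqVneq y (inl 0%R); last by exists 0%R; rewrite eq_sym.
  by exists 1%R.
have [b yb] : exists b, inr b != y.
  have [->|?] := eqVneq y (inr 0%R); last by exists 0%R; rewrite eq_sym.
  by exists 1%R.
have [d cd] : exists d, inr d != c.
  have [->|?] := eqVneq c (inr 0%R); last by exists 0%R; rewrite eq_sym.
  by exists 1%R.
apply: (@realized_collapsing _ _ l_odd co_kl _ a b d) => [|q].
  by rewrite /pin (negPf ya) (negPf yb).
by rewrite /pin; case: ifP => // _; rewrite eq_sym.
Qed.

Lemma sc_root_two_cycle :
  #|collapsing :\: pair_maps s| <= sc (root_lang (dfa_lang two_cycle_dfa)).
Proof.
(* The empty word is a dummy for maps outside [collapsing], so that [choice] gives a total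
   function. *)
have wordP f : exists w, f \in collapsing -> forall q, foldl (@step k' l') q w = f q.
  have [/collapsing_realized[w wE]|_] := boolP (f \in collapsing); last by exists [::].
  by exists w.
have {wordP} [word wordP] := choice wordP.
apply: (sc_ge_card (word := word)).
  by apply: regular_root_lang; exists two_cycle_dfa.
move=> f g; rewrite !in_setD => /andP[fN fC] /andP[gN gC] fg.
have sep (f1 g1 : {ffun Q -> Q}) : f1 \in collapsing -> g1 \in collapsing ->
  pin_separated s f1 g1 -> exists v,
    root_lang (dfa_lang two_cycle_dfa) (word f1 ++ v) /\
    ~ root_lang (dfa_lang two_cycle_dfa) (word g1 ++ v).
  move=> f1C g1C [y [c [cs fr gr]]]; have [v vE] := pin_realized y c.
  have runE h : h \in collapsing ->
      foldl (@step k' l') ^~ (word h ++ v) = pin s y c \o h.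
    by move=> hC; apply/funext => q; rewrite foldl_cat (wordP _ hC) vE.
  by exists v; split; [apply/root_two_cycle|move=> /root_two_cycle]; rewrite runE.
have fg' : (f : Q -> Q) <> g by move=> e; move/eqP: fg; apply; apply/ffunP => q; rewrite e.
case: (pin_separated_or s fg') =>
  [/(sep f g fC gC)[v [h1 h2]]|/(sep g f gC fC)[v [h1 h2]]|[h1 h2 h3]].
- by exists v => -[h _]; apply: h2; apply: h.
- by exists v => -[_ h]; apply: h2; apply: h.
- by case/orP: (pair_maps_exceptional h1 h2 h3); rewrite ?(negPf fN) ?(negPf gN).
Qed.

Lemma card_state : #|{: Q}| = n.
Proof. by rewrite card_sum !card_ord. Qed.

(** [N1] counts the maps without collision between the cycles, [N2] those covering the second
    cycle. *)
Lemma card_collapsing : exists N1 N2,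
  [/\ n ^ n <= #|collapsing| + (N1 + N2),
      N1 * (k * l + n.-1) <= n.-1 * n ^ n
    & N2 * (2 * n + l * l.-1) <= 2 * n * n ^ n].
Proof.
pose A : {set Q} := [set inl a | a in 'I_k].
pose B : {set Q} := [set inr b | b in 'I_l].
pose S1 := [set f : {ffun Q -> Q} | [forall i in A, forall j in B, f i != f j]].
pose S2 := [set f : {ffun Q -> Q} | [forall b : 'I_l, inr b \in codom f]].
have cardA : #|A| = k by rewrite card_imset ?card_ord // => ? ? [].
have cardB : #|B| = l by rewrite card_imset ?card_ord // => ? ? [].
have AB : [disjoint A & B].
  by apply/pred0P => q /=; apply/andP => -[/imsetP[a _ ->] /imsetP[b _]].
have cardF : #|{ffun Q -> Q}| = n ^ n by rewrite card_ffun card_state.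
exists #|S1|, #|S2|; split.
- rewrite -cardF -(cardsC collapsing) leq_add2l.
  apply: leq_trans (leq_card_setU S1 S2); apply/subset_leq_card/subsetP => f.
  rewrite !inE negb_and => /orP[/existsPn fS|/existsPn fS]; apply/orP; [left|right].
    apply/forall_inP => _ /imsetP[a _ ->]; apply/forall_inP => _ /imsetP[b _ ->].
    by have /existsPn := fS a.
  by apply/forallP => b; have := fS b; rewrite negbK.
- have := @card_no_collision Q Q A B AB; rewrite cardA cardB card_state cardF; exact.
- have inr_inj' : injective (fun b : 'I_l => inr b : Q) by move=> ? ? [].
  have := card_codom_sup Q s inr_inj'; rewrite !card_state card_ord -/S2 => le2.
  apply: leq_trans (leq_mul le2 (leqnn _)) _.
  rewrite mulnAC; apply: leq_trans (leq_mul (ffact_bound _ _) (leqnn _)) _.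
  by rewrite -mulnA -expnD subnKC // leq_addl.
Qed.
End Automaton.

(** * Choice of the cycle lengths and the integer bound *)

Lemma coprime_add_pow2 a b d c : odd a -> d = 2 ^ c -> b = a + d -> coprime a b.
Proof.
move=> ao -> ->; rewrite /coprime gcdnDl -/(coprime _ _) coprime_sym.
by rewrite coprimeXl // coprime2n.
Qed.

(* [(N1 + N2) / X <= 4 / (n + c1) + 8 / (n + c2) <= 12 / (n + 4)] *)
Lemma density_bound n p q c1 c2 N1 N2 X : 1 < n ->
  (c1, c2) \in [:: (4, 4); (3, 6)] ->
  n.-1 * (n + c1) <= 4 * (p + n.-1) -> n * (n + c2) <= 4 * (2 * n + q) ->
  N1 * (p + n.-1) <= n.-1 * X -> N2 * (2 * n + q) <= 2 * n * X ->
  (N1 + N2) * (n + 4) <= 12 * X.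
Proof.
move=> n1 cE h1 h2 b1 b2.
have e1 : N1 * (n + c1) <= 4 * X.
  rewrite -(@leq_pmul2l n.-1); last by lia.
  rewrite mulnCA; apply: leq_trans (leq_mul (leqnn _) h1) _.
  by rewrite mulnCA [leqRHS]mulnCA leq_mul2l b1.
have e2 : N2 * (n + c2) <= 8 * X.
  rewrite -(@leq_pmul2l n); last exact: ltnW.
  rewrite mulnCA; apply: leq_trans (leq_mul (leqnn _) h2) _.
  rewrite mulnCA; apply: leq_trans (leq_mul (leqnn 4) b2) _.
  by rewrite (mulnCA n 8) (mulnA 4) (mulnA 4) -[8]/(4 * 2) -!mulnA.
move: cE; rewrite !inE => /orP[]/eqP[? ?]; subst c1 c2; first by rewrite mulnDl; lia.
rewrite -(@leq_pmul2l ((n + 3) * (n + 6))); last by rewrite muln_gt0 !addn_gt0 !orbT.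
have f1 : (n + 4) * (n + 6) * (N1 * (n + 3)) <= (n + 4) * (n + 6) * (4 * X).
  by rewrite leq_mul2l e1 orbT.
have f2 : (n + 4) * (n + 3) * (N2 * (n + 6)) <= (n + 4) * (n + 3) * (8 * X).
  by rewrite leq_mul2l e2 orbT.
rewrite (_ : _ * _ = (n + 4) * (n + 6) * (N1 * (n + 3))
  + (n + 4) * (n + 3) * (N2 * (n + 6))); last by ring.
apply: leq_trans (leq_add f1 f2) _.
rewrite [leqRHS](_ : _ = (n + 4) * (n + 6) * (4 * X)
  + (n + 4) * (n + 3) * (8 * X) + 12 * (n + 2) * X); last by ring.
exact: leq_addr.
Qed.

(** The lengths differ by 2, 1, 4, 1 as [n] is 0, 1, 2, 3 modulo 4. Difference 4 lowers [k * l] and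
    raises [l], whence the constants [(3, 6)] in that case. *)
Lemma cycle_lengths n : 7 <= n -> exists k' l',
  [/\ n = k'.+3 + l'.+3, odd l'.+3, coprime k'.+3 l'.+3 &
    exists2 c, c \in [:: (4, 4); (3, 6)] &
      n.-1 * (n + c.1) <= 4 * (k'.+3 * l'.+3 + n.-1) /\
      n * (n + c.2) <= 4 * (2 * n + l'.+3 * l'.+2)].
Proof.
move=> n7; have := divn_eq n 4; have := ltn_pmod n (isT : 0 < 4).
move: (n %/ 4) (n %% 4) => m [|[|[|[|//]]]] _ nE; subst n.
- case: m n7 => [|[|m]] // n7; exists (2 * m), (2 * m + 2).
  split; [lia|lia| |exists (4, 4) => //=; split; nia].
  by apply: (@coprime_add_pow2 _ _ 2 1); lia.
- case: m n7 => [|[|m]] // n7; exists (2 * m + 1), (2 * m + 2).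
  split; [lia|lia| |exists (4, 4) => //=; split; nia].
  by rewrite (_ : (2 * m + 2).+3 = (2 * m + 1).+4) ?coprimenS //; lia.
- case: m n7 => [|[|m]] // n7; exists (2 * m), (2 * m + 4).
  split; [lia|lia| |exists (3, 6) => //=; split; nia].
  by apply: (@coprime_add_pow2 _ _ 4 2); lia.
- case: m n7 => [|m] // n7; exists (2 * m + 1), (2 * m).
  split; [lia|lia| |exists (4, 4) => //=; split; nia].
  by rewrite (_ : (2 * m + 1).+3 = (2 * m).+4) ?coprimeSn //; lia.
Qed.

(** Integer form of the lower bound [n ^ n * (1 - 12 / (n + 4)) - 'C(n, 2)]. *)
Lemma sc_root_lower_bound n : 7 <= n -> exists L : language bool,
  [/\ regular_lang L, sc L <= n &
    (n + 4) * n ^ n <= (n + 4) * (sc (root_lang L) + 'C(n, 2)) + 12 * n ^ n].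
Proof.
move=> n7; have [k' [l' [nE lo co [[c1 c2] cE [/= h1 h2]]]]] := cycle_lengths n7.
have reg : regular_lang (dfa_lang (two_cycle_dfa k' l')) by exists (two_cycle_dfa k' l').
exists (dfa_lang (two_cycle_dfa k' l')); split=> //.
  have [_ min] := scP reg; apply: leq_trans (min (two_cycle_dfa k' l') erefl) _.
  by rewrite card_state nE.
have := sc_root_two_cycle lo co; have := card_pair_maps (inl 0%R : state k' l').
have [N1 [N2]] := card_collapsing k' l'.
rewrite card_state -nE => -[b0 b1 b2] ce le.
have bad := density_bound (@leq_trans 7 2 n isT n7) cE h1 h2 b1 b2.
have le' : #|collapsing k' l'| <= sc (root_lang (dfa_lang (two_cycle_dfa k' l'))) + 'C(n, 2).
  rewrite -(cardsID (pair_maps (inl 0%R)) (collapsing k' l')) addnC leq_add //.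
  exact: leq_trans (subset_leq_card (subsetIr _ _)) ce.
have : (n + 4) * n ^ n <= (n + 4) * (#|collapsing k' l'| + (N1 + N2)) by rewrite leq_mul2l b0 orbT.
rewrite mulnDr [(n + 4) * (N1 + N2)]mulnC => le1.
apply: leq_trans le1 _; apply: leq_add bad.
by rewrite leq_mul2l le' orbT.
Qed.

(* Passage to the real bound *)
From HB Require Import structures.
From mathcomp Require Import all_boot all_order all_algebra.
From mathcomp Require Import all_classical all_reals all_analysis.

Local Open Scope ring_scope.

(** Squared, this is [18 * n <= (n + 4) ^ 2], that is [0 <= (n - 2) * (n - 8)]. *)
Lemma sqrt8_lower_bound (R : realType) (n : nat) : (8 <= n)%N ->
  12 / (n%:R + 4) <= Num.sqrt 8 * (1 / Num.sqrt n%:R) :> R.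
Proof.
move=> n8; have n0 : 0 < n%:R :> R by rewrite ltr0n; lia.
have n8' : 8 <= n%:R :> R by rewrite ler_nat.
rewrite mulrA mulr1 ler_pdivrMr; last by lra.
rewrite mulrAC ler_pdivlMr ?sqrtr_gt0 //.
rewrite -[12]ger0_norm // -sqrtr_sqr -[_ + 4]ger0_norm; last by lra.
rewrite -[X in _ <= _ * X]sqrtr_sqr -!sqrtrM ?sqr_ge0 // ler_wsqrtr //; nra.
Qed.

Theorem corollary3p21 (R : realType) (n : nat) (hn : (7 <= n)%N) :
  exists (Sigma : finType) (L : language Sigma),
    [/\ #|Sigma| = 2%N,
        regular_lang L,
        (sc L <= n)%N &
        n%:R ^+ n *
          (1 - Num.sqrt 2 * (2 / expR 1) `^ (n%:R / 2) * expR (1 / 12)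
             - Num.sqrt 8 * (1 / Num.sqrt n%:R) * expR (1 / 12))
          - 'C(n, 2)%:R
        <= (sc (root_lang L))%:R :> R].
Proof.
have [L [reg scL bound]] := sc_root_lower_bound hn.
exists bool, L; split=> //; first exact: card_bool.
set p := _ * expR (1 / 12); set q := _ * (1 / _); set e := expR (1 / 12).
have p0 : 0 <= p by rewrite !mulr_ge0 ?sqrtr_ge0 ?powR_ge0 ?expR_ge0.
have q0 : 0 <= q by rewrite !mulr_ge0 ?sqrtr_ge0 ?invr_ge0 ?sqrtr_ge0.
have e1 : 1 <= e by rewrite -expR0 ler_expR divr_ge0.
have qe : q <= q * e by rewrite ler_peMr.
set X := n%:R ^+ n; have X0 : 0 <= X by rewrite exprn_ge0.
have C0 : 0 <= 'C(n, 2)%:R :> R by [].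
have S0 : 0 <= (sc (root_lang L))%:R :> R by [].
(* Dropping the term [p >= 0] and the factor [e >= 1] only strengthens the claim. *)
suff h : X * (1 - q) - 'C(n, 2)%:R <= (sc (root_lang L))%:R.
  by apply: le_trans h; rewrite lerD2r ler_wpM2l //; lra.
have [n8|] := leqP 8 n; last first.
  move=> n7; have q1 : 1 <= q.
    rewrite /q mulrA mulr1 ler_pdivlMr ?mul1r ?ler_wsqrtr ?ler_nat 1?ltnW // sqrtr_gt0 ltr0n; lia.
  have : X * (1 - q) <= 0 by rewrite mulr_ge0_le0 // subr_le0.
  lra.
have n4 : 0 < n%:R + 4 :> R by rewrite ltr_wpDl.
have : (n%:R + 4) * X <= (n%:R + 4) * ((sc (root_lang L))%:R + 'C(n, 2)%:R) + 12 * X.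
  by rewrite /X -natrX -!natrD -!natrM -natrD ler_nat.
move=> b.
have : 12 / (n%:R + 4) * X <= q * X by rewrite ler_wpM2r // sqrt8_lower_bound.
suff : X - 12 / (n%:R + 4) * X <= (sc (root_lang L))%:R + 'C(n, 2)%:R by lra.
rewrite -(ler_pM2l n4) mulrBr (mulrA (n%:R + 4)) [_ * (12 / _)]mulrC divfK ?lt0r_neq0 //.
by lra.
Qed.
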